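(* Let $g\in\mathbb{R}[x,y]$ be a polynomial of degree $d$ such that the curve $\mathcal{C}=\{g=0\}\subset\mathbb{R}^2$ is in general position (as defined in the context). Suppose that the following are already computed: a good partition $\{x_i\}_{i=1}^n$ for $\mathcal{C}$ with $n=\mathcal{O}(d^2)$; for every $i$, the real roots $y_{i1}<\dots<y_{ir_i}$ of $g(x_i,-)$; and, for every point $(x_i,y_{ij})$, whether it is a regular or a critical point of $\pi$. Then the following two steps can be carried out using $\mathcal{O}(d^3)$ extra additions of integers: (Step 3) for each point $(x_i,y_{ij})$, compute the number $L_{ij}$ of half-branches to the left and the number $R_{ij}$ of half-branches to the right; (Step 4) connect the points $(x_i,y_{ij})$ with edges obeying the branch counts, i.e. construct a graph with vertices $(x_i,y_{ij})$ in which every edge joins points over two consecutive values $x_i,x_{i+1}$, and each $(x_i,y_{ij})$ is joined by $R_{ij}$ edges to points over $x_{i+1}$ (if $i<n$) and by $L_{ij}$ edges to points over $x_{i-1}$ (if $i>1$).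
   Context: Let $\pi:\mathcal{C}\to\mathbb{R}$, $\pi(x,y)=x$. General position means: $\mathcal{C}$ is generically smooth (singular at only finitely many points), $\pi$ has finite fibers, and any two distinct critical points of $\pi$ lie in different fibers of $\pi$. A point of $\mathcal{C}$ is a critical point of $\pi$ if $g_y=\partial g/\partial y$ vanishes there (the point is singular or has a vertical tangent line); other points of $\mathcal{C}$ are regular. A critical value is the image under $\pi$ of a critical point; all other real numbers are regular values. A good partition for $\mathcal{C}$ is a finite set $x_1<\dots<x_n$ of real numbers, $n\ge 2$, such that for every critical value $x$ of $\pi$ there is an $i$ with $x=x_i$ and $x_{i-1},x_{i+1}$ (which must exist) regular values. Write $\pi^{-1}(x_i)=\{y_{i1}<\dots<y_{ir_i}\}$, $0\le r_i\le d$ (points of the fiber are identified with their $y$-coordinates). Branches (standing convention, part of the setting): over each interval $(x_i,x_{i+1})$, $1\le i\le n-1$, the number of real roots of $g(x,-)$ is a constant $\rho_i$, the roots are given by continuous functions $\varphi_{i,1}<\dots<\varphi_{i,\rho_i}:(x_i,x_{i+1})\to\mathbb{R}$, and these extend continuously to $[x_i,x_{i+1}]$, with values at the endpoints in the fibers over $x_i$ and $x_{i+1}$. The number of half-branches to the right at $(x_i,y_{ij})$ is $\#\{k:\varphi_{i,k}(x_i)=y_{ij}\}$, and the number of half-branches to the left is $\#\{k:\varphi_{i-1,k}(x_i)=y_{ij}\}$. For $i=1$ (left) and $i=n$ (right) the branches over a sufficiently small interval to the left of $x_1$, respectively to the right of $x_n$, are used; since $x_1$ and $x_n$ are regular values these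 numbers equal $1$. The cost counts only additions and subtractions of integers. *)

(* Defs.v *)
From HB Require Import structures.
From mathcomp Require Import all_boot all_order all_algebra.
From mathcomp Require Import polyXY.
From mathcomp Require Import all_classical all_reals all_analysis.

Set Implicit Arguments.
Unset Strict Implicit.
Unset Printing Implicit Defensive.

Import Order.TTheory GRing.Theory Num.Theory.
Import numFieldNormedType.Exports.

Local Open Scope classical_set_scope.
Local Open Scope ring_scope.

(* Following polyXY, a real polynomial in x and y is g : {poly {poly R}} whose
   outer indeterminate is x and whose inner indeterminate is y.  Thus g(x, y)
   is g.[x, y], and g.[x%:P] : {poly R} is the polynomial g(x, -) in y. *)

Section Curve.
Variables (R : realType) (g : {poly {poly R}}).

Definition total_degree : nat :=
  \max_(i < size g | (g`_i != 0)%R) (i + (size (g`_i)%R).-1)%N.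

Definition dx : {poly {poly R}} := g^`().

Definition dy : {poly {poly R}} := map_poly (fun p : {poly R} => p^`()) g.

Definition on_curve (x y : R) : Prop := g.[x, y] = 0.

Definition critical_point (x y : R) : Prop := on_curve x y /\ dy.[x, y] = 0.

Definition singular_point (x y : R) : Prop :=
  [/\ on_curve x y, dx.[x, y] = 0 & dy.[x, y] = 0].

Definition critical_value (x : R) : Prop := exists y, critical_point x y.

Definition regular_value (x : R) : Prop := ~ critical_value x.

Definition general_position : Prop :=
  [/\ finite_set [set p : R * R | singular_point p.1 p.2],
      forall x, finite_set [set y | on_curve x y]
    & forall x1 y1 x2 y2, critical_point x1 y1 -> critical_point x2 y2 ->
        (x1, y1) <> (x2, y2) -> x1 <> x2].

(* All indices are shifted to start from 0: xs`_i is the (i+1)-st abscissa. *)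
Definition good_partition (xs : seq R) : Prop :=
  [/\ sorted <%R xs, (2 <= size xs)%N
    & forall x, critical_value x -> exists i : nat,
        [/\ (0 < i)%N, (i.+1 < size xs)%N, x = xs`_i,
            regular_value xs`_i.-1 & regular_value xs`_i.+1]].

(* ys lists the real roots of g(x, -) in increasing order. *)
Definition real_roots (x : R) (ys : seq R) : Prop :=
  sorted <%R ys /\ forall y, y \in ys = root g.[x%:P] y.

(* br = [:: phi_1; ...; phi_rho] lists the branches over the open interval
   from a to b; the values of the phi_k outside that interval are not used. *)
Definition branches (a b : R) (br : seq (R -> R)) : Prop :=
  (forall k : 'I_(size br), {in `]a, b[, continuous (nth (fun=> 0) br k)}) /\
  (forall x, x \in `]a, b[ -> real_roots x [seq phi x | phi <- br]).

(* The continuous extensions to [a, b] are the values phi_k a and phi_k b. *)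
Definition extended_branches (a b : R) (br : seq (R -> R)) : Prop :=
  branches a b br /\
  forall k : 'I_(size br), let phi := nth (fun=> 0) br k in
    [/\ {within `[a, b], continuous phi}, on_curve a (phi a)
      & on_curve b (phi b)].

End Curve.

(* Half-branches at the point (xs`_i, (ys i)`_j), where br i lists the branches
   between xs`_i and xs`_i.+1, and brL, brR list those over an interval to the
   left of the first, resp. to the right of the last, abscissa.  A branch in brL
   or brR may escape to infinity at that abscissa (vertical asymptote of the
   curve), so incidence is expressed there by a one-sided limit. *)

Section HalfBranches.
Variables (R : realType) (xs : seq R) (ys : nat -> seq R).
Variables (br : nat -> seq (R -> R)) (brL brR : seq (R -> R)).

Definition left_half_branches (i j : nat) : nat :=
  if i is i'.+1 then count (fun phi => phi xs`_i == (ys i)`_j) (br i')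
  else count (fun phi : R -> R =>
         `[< phi x @[x --> xs`_i^'-] --> (ys i)`_j >]) brL.

Definition right_half_branches (i j : nat) : nat :=
  if (i.+1 < size xs)%N then count (fun phi => phi xs`_i == (ys i)`_j) (br i)
  else count (fun phi : R -> R =>
         `[< phi x @[x --> xs`_i^'+] --> (ys i)`_j >]) brR.

End HalfBranches.

(* Vertices are pairs (i, j), standing for the point (xs`_i, (ys i)`_j); an
   edge is stored with its endpoint over the smaller abscissa first. *)
Definition vertex := (nat * nat)%type.
Definition edge := (vertex * vertex)%type.

(* n : number of fibers; r i : number of points of the i-th fiber. *)
Definition obeys_branch_counts (n : nat) (r : nat -> nat)
    (L Rt : nat -> nat -> nat) (E : seq edge) : Prop :=
  let is_vertex (v : vertex) := (v.1 < n)%N && (v.2 < r v.1)%N in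
  [/\ uniq E,
      forall e, e \in E ->
        [/\ is_vertex e.1, is_vertex e.2 & e.2.1 = e.1.1.+1],
      forall v, is_vertex v -> (v.1.+1 < n)%N ->
        count (fun e => e.1 == v) E = Rt v.1 v.2
    & forall v, is_vertex v -> (0 < v.1)%N ->
        count (fun e => e.2 == v) E = L v.1 v.2].

(* Algorithms are programs of a while-language over a memory made of integer
   arrays with two integer indices.  The only operations creating new integers
   are addition and subtraction, and each execution of one of them costs 1
   (including those on loop counters); reading, copying and comparing are
   free.  A program is a fixed finite object, independent of its input. *)

Definition store := nat -> int -> int -> int.

Inductive operand : Type :=
| Lit of int
| Cell of nat & operand & operand.

Inductive cmd : Type :=
| Skip
| Copy of nat & operand & operand & operand
| AddTo of nat & operand & operand & operand & operand
| SubTo of nat & operand & operand & operand & operand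
| Seq of cmd & cmd
| IfLe of operand & operand & cmd & cmd
| WhileLe of operand & operand & cmd.

Fixpoint value (s : store) (o : operand) : int :=
  match o with
  | Lit z => z
  | Cell a i j => s a (value s i) (value s j)
  end.

Definition update (s : store) (a : nat) (i j v : int) : store :=
  fun a' i' j' => if [&& a' == a, i' == i & j' == j] then v else s a' i' j'.

(* exec c s k s' : run from s, c terminates in s' after k additions and
   subtractions.  The target of an assignment is the cell a[i, j]. *)
Inductive exec : cmd -> store -> nat -> store -> Prop :=
| ExecSkip s : exec Skip s 0 s
| ExecCopy a i j o s :
    exec (Copy a i j o) s 0 (update s a (value s i) (value s j) (value s o))
| ExecAdd a i j o1 o2 s :
    exec (AddTo a i j o1 o2) s 1
      (update s a (value s i) (value s j) (value s o1 + value s o2))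
| ExecSub a i j o1 o2 s :
    exec (SubTo a i j o1 o2) s 1
      (update s a (value s i) (value s j) (value s o1 - value s o2))
| ExecSeq c1 c2 s1 s2 s3 k1 k2 :
    exec c1 s1 k1 s2 -> exec c2 s2 k2 s3 ->
    exec (Seq c1 c2) s1 (k1 + k2)%N s3
| ExecIfTrue o1 o2 c1 c2 s k s' :
    value s o1 <= value s o2 -> exec c1 s k s' -> exec (IfLe o1 o2 c1 c2) s k s'
| ExecIfFalse o1 o2 c1 c2 s k s' :
    ~~ (value s o1 <= value s o2) -> exec c2 s k s' ->
    exec (IfLe o1 o2 c1 c2) s k s'
| ExecWhileTrue o1 o2 c s1 s2 s3 k1 k2 :
    value s1 o1 <= value s1 o2 -> exec c s1 k1 s2 ->
    exec (WhileLe o1 o2 c) s2 k2 s3 ->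
    exec (WhileLe o1 o2 c) s1 (k1 + k2)%N s3
| ExecWhileFalse o1 o2 c s :
    ~~ (value s o1 <= value s o2) -> exec (WhileLe o1 o2 c) s 0 s.

Definition arr_n : nat := 0.
Definition arr_r : nat := 1.
Definition arr_crit : nat := 2.
Definition arr_L : nat := 3.
Definition arr_R : nat := 4.
Definition arr_m : nat := 5.
Definition arr_E : nat := 6.

(* Of the precomputed data, a program is given the number of fibers, their
   cardinalities and the critical/regular flags; cells not mentioned here
   have arbitrary contents. *)
Definition has_input (R : realType) (g : {poly {poly R}}) (xs : seq R)
    (ys : nat -> seq R) (s : store) : Prop :=
  s arr_n 0 0 = (size xs)%:Z /\
  forall i : nat, (i < size xs)%N ->
    s arr_r i%:Z 0 = (size (ys i))%:Z /\
    forall j : nat, (j < size (ys i))%N ->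
      s arr_crit i%:Z j%:Z =
        if `[< critical_point g xs`_i (ys i)`_j >] then 1 else 0.

Definition has_counts (n : nat) (r : nat -> nat) (L Rt : nat -> nat -> nat)
    (s : store) : Prop :=
  forall i j : nat, (i < n)%N -> (j < r i)%N ->
    s arr_L i%:Z j%:Z = (L i j)%:Z /\ s arr_R i%:Z j%:Z = (Rt i j)%:Z.

(* Row k of the array arr_E holds the four indices of the k-th edge. *)
Definition has_edges (E : seq edge) (s : store) : Prop :=
  s arr_m 0 0 = (size E)%:Z /\
  forall k : nat, (k < size E)%N ->
    let e := nth ((0, 0), (0, 0))%N E k in
    [/\ s arr_E k%:Z 0 = e.1.1%:Z, s arr_E k%:Z 1 = e.1.2%:Z,
        s arr_E k%:Z 2 = e.2.1%:Z & s arr_E k%:Z 3 = e.2.2%:Z].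

(* Main.v *)
Require Import Defs.
From HB Require Import structures.
From mathcomp Require Import all_boot all_order all_algebra.
From mathcomp Require Import polyXY.
From mathcomp Require Import all_classical all_reals all_analysis.
From mathcomp Require Import zify.
From mathcomp Require polyrcf.

Set Implicit Arguments.
Unset Strict Implicit.
Unset Printing Implicit Defensive.

Import Order.TTheory GRing.Theory Num.Theory.
Import numFieldNormedType.Exports.

Local Open Scope classical_set_scope.
Local Open Scope ring_scope.

(* At a regular point (x0, y0) the polynomials g(x, -), x near x0, are strictly
   monotone on a fixed small interval around y0, so exactly one half-branch
   leaves the point on each side.  Every branch over (x_i, x_i.+1) ends at one
   point of each of the two fibers, hence the counts R over x_i and the counts
   L over x_i.+1 have the same sum.  As the fiber of a critical value contains
   a single critical point and its neighbours are regular fibers, the counts of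
   that point are r_(i-1) - r_i + 1 and r_(i+1) - r_i + 1.  For Step 4, list the
   right stubs over x_i and the left stubs over x_i.+1 in order and join them by
   rank; the two lists are produced by two independent passes over all points,
   writing the two halves of the edge table. *)

(** * The curve near a regular point *)

Lemma dy_horner (R : realType) (g : {poly {poly R}}) (x : R) :
  (dy g).[x%:P] = g.[x%:P]^`().
Proof.
rewrite horner_poly horner_coef linear_sum; apply: eq_bigr => i _ /=.
by rewrite derivM -rmorphXn derivC mulr0 addr0.
Qed.

Lemma continuous_horner2 (R : realType) (g : {poly {poly R}}) :
  continuous (fun p : R * R => g.[p.1, p.2]).
Proof.
elim/poly_ind: g => [|g c IHg] p.
  by under eq_fun do rewrite !horner0; exact: cvg_cst.
under eq_fun do rewrite hornerMXaddC hornerD hornerM hornerC.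
apply: cvgD.
  by apply: cvgM; [exact: IHg|exact: cvg_fst].
by apply: continuous_comp; [exact: cvg_snd|exact: continuous_horner].
Qed.

(** Put [D = g_y(x0, y0)], which is nonzero. By continuity [D * g_y > 0] near the point, so
    [D * g(x, -)] is strictly increasing on a fixed interval around [y0], and its signs at the two
    ends persist for [x] near [x0]. The nonvanishing on the horizontal sides is what later keeps a
    branch inside the box. *)
Lemma root_box (R : realType) (g : {poly {poly R}}) (x0 y0 e : R) :
  on_curve g x0 y0 -> ~ critical_point g x0 y0 -> 0 < e ->
  exists e' d : R, [/\ 0 < e' <= e, 0 < d & forall x, `|x - x0| < d ->
    [/\ g.[x, y0 - e'] != 0, g.[x, y0 + e'] != 0,
        exists2 y, `|y - y0| < e' & g.[x, y] = 0
      & forall y z, `|y - y0| < e' -> `|z - y0| < e' ->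
          g.[x, y] = 0 -> g.[x, z] = 0 -> y = z]].
Proof.
move=> g0 ncr e_gt0; set D := (dy g).[x0, y0].
have D0 : D != 0 by apply/eqP => D0; apply: ncr.
have near_pos (h : {poly {poly R}}) (c x y : R) : 0 < c * h.[x, y] ->
    exists2 r, 0 < r & forall x' y', `|x' - x| < r -> `|y' - y| < r ->
      0 < c * h.[x', y'].
  move=> h_gt0.
  have cvgh : c * h.[p.1, p.2] @[p --> (x, y)] --> c * h.[x, y].
    by apply: cvgM; [exact: cvg_cst|exact: (@continuous_horner2 R h (x, y))].
  have /nbhs_ballP[r /= r0 hr] :
      nbhs ((x, y) : R * R) [set p : R * R | 0 < c * h.[p.1, p.2]].
    exact: (cvgr_gt _ cvgh _ h_gt0).
  exists r => // x' y' hx hy.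
  by apply: (hr (x', y')); split; rewrite /ball /= distrC.
(* Multiplying by [D] treats both signs of the derivative at once: at the centre the product is
   [D ^ 2]. *)
have [r r0 dyr] : exists2 r, 0 < r & forall x' y', `|x' - x0| < r ->
    `|y' - y0| < r -> 0 < D * (dy g).[x', y'].
  by apply: near_pos; rewrite -expr2 exprn_even_gt0.
(* Halving [r] keeps the closed interval of radius [e'] inside the region where the sign of
   [D * g_y] is known. *)
pose e' := Num.min e (r / 2).
have e'0 : 0 < e' by rewrite lt_min e_gt0 divr_gt0.
have e'e : e' <= e by rewrite ge_min lexx.
have e'r : e' < r.
  by rewrite gt_min; apply/orP; right; rewrite ltr_pdivrMr// mulr_natr mulr2n ltrDl.
have incr x y z : `|x - x0| < r -> `|y - y0| <= e' -> `|z - y0| <= e' ->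
    y < z -> D * g.[x, y] < D * g.[x, z].
  move=> xr; rewrite !ler_distl => /andP[y1 y2] /andP[z1 z2] yz.
  have [c] := polyrcf.poly_mvt g.[x%:P] yz.
  rewrite in_itv /= => /andP[yc cz] E.
  rewrite -subr_gt0 -mulrBr E mulrA mulr_gt0 ?subr_gt0// -dy_horner dyr//.
  rewrite (le_lt_trans _ e'r)// ler_distl.
  by rewrite (le_trans y1 (ltW yc)) (le_trans (ltW cz) z2).
have ex0 : `|x0 - x0| < r by rewrite subrr normr0.
have ey0 : `|y0 - y0| <= e' by rewrite subrr normr0 ltW.
have em : `|y0 - e' - y0| <= e' by rewrite addrAC subrr add0r normrN gtr0_norm.
have ep : `|y0 + e' - y0| <= e' by rewrite addrAC subrr add0r gtr0_norm.
have [r1 r10 H1] : exists2 r, 0 < r & forall x' y', `|x' - x0| < r ->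
    `|y' - (y0 - e')| < r -> 0 < - D * g.[x', y'].
  apply: near_pos; rewrite mulNr oppr_gt0.
  have := incr _ _ _ ex0 em ey0; rewrite g0 mulr0; apply.
  by rewrite ltrBlDr ltrDl.
have [r2 r20 H2] : exists2 r, 0 < r & forall x' y', `|x' - x0| < r ->
    `|y' - (y0 + e')| < r -> 0 < D * g.[x', y'].
  apply: near_pos.
  have := incr _ _ _ ex0 ey0 ep; rewrite g0 mulr0; apply.
  by rewrite ltrDl.
(* [r] serves the monotonicity in [y], [r1] and [r2] the signs on the lower and upper sides. *)
exists e', (Num.min r (Num.min r1 r2)); split; rewrite ?e'0 ?lt_min ?r0 ?r10//.
move=> x; rewrite !lt_min => /and3P[xr xr1 xr2].
have L : D * g.[x, y0 - e'] < 0.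
  by rewrite -oppr_gt0 -mulNr; apply: H1; rewrite // subrr normr0.
have U : 0 < D * g.[x, y0 + e'].
  by apply: H2; rewrite // subrr normr0.
have Lne : g.[x, y0 - e'] != 0.
  by apply: contraTneq L => ->; rewrite mulr0 ltxx.
have Une : g.[x, y0 + e'] != 0.
  by apply: contraTneq U => ->; rewrite mulr0 ltxx.
split=> //.
  have [||y /andP[y1 y2]] := @poly_ivt _ (D *: g.[x%:P]) (y0 - e') (y0 + e').
  - by rewrite lerD2l ge0_cp// ltW.
  - by rewrite !hornerZ !ltW.
  rewrite /root hornerZ mulf_eq0 (negPf D0) /= => /eqP gxy; exists y => //.
  rewrite ltr_distl !lt_neqAle y1 y2 !andbT.
  by apply/andP; split;
    [apply: contraNneq Lne => ->|apply: contraNneq Une => <-]; apply/eqP.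
move=> y z /ltW yb /ltW zb gy gz.
by have [yz|yz|//] := ltgtP y z;
  [have := incr _ _ _ xr yb zb yz|have := incr _ _ _ xr zb yb yz];
  rewrite gy gz ltxx.
Qed.

Lemma count_eq1 (T : Type) (x0 : T) (p : pred T) (s : seq T) (k : nat) :
  (k < size s)%N -> p (nth x0 s k) ->
  (forall l, (l < size s)%N -> p (nth x0 s l) -> l = k) -> count p s = 1%N.
Proof.
elim: s k => //= z s IHs [|k] /=.
  move=> _ pz uq; rewrite pz; suff /eqP -> : count p s == 0%N by [].
  rewrite -leqn0 leqNgt -has_count; apply/negP => /(has_nthP x0) -[l ls pl].
  by have := uq l.+1 ls pl.
move=> ks pk uq; rewrite (IHs k)//.
  by case pz: (p z) => //; have := uq 0%N isT pz.
by move=> l ls pl; apply: succn_inj; exact: uq.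
Qed.

(** * Half-branches at a regular point *)

Section BranchLimits.
Variables (R : realType) (g : {poly {poly R}}) (u v : R) (br : seq (R -> R)).
Hypothesis br_branches : branches g u v br.
Variables (x0 y0 : R) (F : set_system R).
Hypothesis FF : ProperFilter F.
(* F is meant to be x0^'- or x0^'+. *)
Hypothesis F_basis : forall d : R, 0 < d -> exists A : set R,
  [/\ F A, is_interval A & forall x, A x -> (x \in `]u, v[) /\ (`|x - x0| < d)].
Hypothesis gx0y0 : on_curve g x0 y0.
Hypothesis x0y0_regular : ~ critical_point g x0 y0.

Let phi k : R -> R := nth (fun=> 0) br k.

Let phi_root k x : (k < size br)%N -> x \in `]u, v[ -> g.[x, phi k x] = 0.
Proof.
move=> ks xuv; have [_ rts] := proj2 br_branches x xuv; apply/eqP; rewrite -/(root _ _) -rts.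
by apply/mapP; exists (phi k) => //; exact: mem_nth.
Qed.

Let phi_inj k l x : (k < size br)%N -> (l < size br)%N -> x \in `]u, v[ ->
  phi k x = phi l x -> k = l.
Proof.
move=> ks ls xuv E.
have [/lt_sorted_uniq us _] := proj2 br_branches x xuv.
apply/eqP; rewrite -(nth_uniq 0 _ _ us) ?size_map//.
by rewrite !(nth_map (fun=> 0))//; apply/eqP.
Qed.

(** The branch is chosen through the root of the box over one abscissa [x]. It cannot leave the box
    over the interval [A], since it would have to cross a horizontal side, where [g] does not
    vanish. At this stage [k] may still depend on [e]. *)
Lemma eventually_branch (e : R) : 0 < e ->
  exists2 k, (k < size br)%N & \forall x \near F, `|phi k x - y0| < e.
Proof.
move=> /(root_box gx0y0 x0y0_regular)[e' [d [/andP[e'0 e'e] d0 box]]].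
have [A [FA itA Ab]] := F_basis d0.
have [x Ax] := filter_ex FA; have [xuv xd] := Ab x Ax.
have [_ _ [y yb gy] _] := box x xd.
have : y \in [seq f x | f <- br].
  by rewrite (proj2 ((proj2 br_branches) x xuv)); apply/eqP.
case/(nthP 0) => k; rewrite size_map => ks; rewrite (nth_map (fun=> 0))//.
rewrite -/(phi k) => phiky; exists k => //.
apply: filterS FA => z Az; apply: lt_le_trans e'e.
have [zuv zd] := Ab z Az.
have cphi a b : A a -> A b -> {within `[a, b], continuous (phi k)}.
  move=> Aa Ab'; apply: continuous_in_subspaceT => t.
  rewrite inE /= in_itv /= => /andP[ta tb].
  apply: ((proj1 br_branches) (Ordinal ks)); apply: (proj1 (Ab t _)).
  by apply: (itA a b) => //; rewrite ta tb.
have avoid w : A w -> phi k w != y0 - e' /\ phi k w != y0 + e'.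
  move=> Aw; have [wuv wd] := Ab w Aw; have [n1 n2 _ _] := box w wd.
  by split; [apply: contraNneq n1|apply: contraNneq n2] => <-;
    rewrite phi_root.
(* Being inside at [x] and outside at [z] forces, by the intermediate value theorem, a crossing of a
   side over some [c]; this will contradict [avoid]. *)
have hit : (y0 - e' < phi k x < y0 + e') -> ~~ (y0 - e' < phi k z < y0 + e') ->
    exists2 c, A c & (phi k c = y0 - e' \/ phi k c = y0 + e').
  have mm (s t w' : R) : A s -> A t -> s <= t ->
     (phi k s <= w' <= phi k t) || (phi k t <= w' <= phi k s) ->
     exists2 c, A c & phi k c = w'.
    move=> As At st H.
    have [|c] := @IVT R (phi k) s t w' st (cphi _ _ As At).
      case/orP: H => /andP[H1 H2]; rewrite ge_min le_max.
        by rewrite H1 H2 orbT.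
      by rewrite H1 H2 orbT.
    by rewrite in_itv /= => cst; exists c => //; exact: (itA s t).
  move=> /andP[x1 x2]; rewrite negb_and -!leNgt => /orP[z1|z1].
    have [xz|/ltW xz] := leP x z.
      by have [|c] := mm x z (y0 - e') Ax Az xz;
        [rewrite z1 (ltW x1) orbT|exists c => //; left].
    by have [|c] := mm z x (y0 - e') Az Ax xz;
      [rewrite z1 (ltW x1)|exists c => //; left].
  have [xz|/ltW xz] := leP x z.
    by have [|c] := mm x z (y0 + e') Ax Az xz;
      [rewrite z1 (ltW x2)|exists c => //; right].
  by have [|c] := mm z x (y0 + e') Az Ax xz;
    [rewrite z1 (ltW x2) orbT|exists c => //; right].
rewrite ltr_distl; apply/negPn/negP => nz.
have [|c /avoid[/eqP n1 /eqP n2] []//] := hit _ nz.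
by rewrite phiky -ltr_distl.
Qed.

(** One box with a single root over each abscissa shows that all branches eventually inside it
    coincide. Hence the index found for a smaller radius is always the same [k], so this branch
    converges to [y0], and no other one does. *)
Lemma count_branches_at_regular_point :
  count (fun f : R -> R => `[< f x @[x --> F] --> y0 >]) br = 1%N.
Proof.
have [e1 [d1 [/andP[e1_gt0 _] d1_gt0 box]]] :=
  root_box gx0y0 x0y0_regular ltr01.
have [A [FA _ Ab]] := F_basis d1_gt0.
have same k l : (k < size br)%N -> (l < size br)%N ->
    (\forall x \near F, `|phi k x - y0| < e1) ->
    (\forall x \near F, `|phi l x - y0| < e1) -> k = l.
  move=> ks ls Fk Fl.
  have [x [[Ax kx] lx]] := filter_ex (filterI (filterI FA Fk) Fl).
  have [xuv xd] := Ab x Ax; have [_ _ _ uq] := box x xd.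
  by apply: (phi_inj ks ls xuv); apply: uq; rewrite ?phi_root.
have [k ks Fk] := eventually_branch e1_gt0.
apply: (@count_eq1 _ (fun=> 0) _ _ k ks).
  apply/asboolP/cvgrPdist_lt => e e_gt0.
  (* The radius [e] gives the limit, while [e1] identifies the new index with [k]. *)
  have [|l ls Fl] := @eventually_branch (Num.min e e1).
    by rewrite lt_min e_gt0.
  have -> : k = l.
    apply: same => //; apply: filterS Fl => x; rewrite lt_min.
    by case/andP.
  apply: filterS Fl => x; rewrite lt_min => /andP[+ _].
  by rewrite distrC.
move=> l ls /asboolP /cvgrPdist_lt /(_ _ e1_gt0) Fl; apply: same => //.
by apply: filterS Fl => x; rewrite distrC.
Qed.

End BranchLimits.

Section Endpoints.
Variables (R : realType) (g : {poly {poly R}}).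
Implicit Types (a b y : R) (br : seq (R -> R)).

Lemma count_branches_at_left a b y br : a < b -> branches g a b br ->
  on_curve g b y -> ~ critical_point g b y ->
  count (fun f : R -> R => `[< f x @[x --> b^'-] --> y >]) br = 1%N.
Proof.
move=> ab bbr gby ncr.
apply: (count_branches_at_regular_point bbr (at_left_proper_filter b) _ gby ncr).
move=> d d_gt0; exists `]Num.max a (b - d), b[%classic; split.
- have M : Num.max a (b - d) < b by rewrite gt_max ab ltrBlDr ltrDl.
  near=> x; rewrite /= in_itv /=; apply/andP; split; near: x.
    exact: nbhs_left_gt.
  exact: nbhs_left_lt.
- exact: interval_is_interval.
- move=> x /=; rewrite !in_itv /= gt_max => /andP[/andP[-> bdx] xb].
  by rewrite xb ltr_distl bdx (lt_trans xb)// ltrDl.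
Unshelve. all: by end_near. Qed.

Lemma count_branches_at_right a b y br : a < b -> branches g a b br ->
  on_curve g a y -> ~ critical_point g a y ->
  count (fun f : R -> R => `[< f x @[x --> a^'+] --> y >]) br = 1%N.
Proof.
move=> ab bbr gay ncr.
apply: (count_branches_at_regular_point bbr (at_right_proper_filter a) _ gay ncr).
move=> d d_gt0; exists `]a, Num.min b (a + d)[%classic; split.
- have M : a < Num.min b (a + d) by rewrite lt_min ab ltrDl.
  near=> x; rewrite /= in_itv /=; apply/andP; split; near: x.
    exact: nbhs_right_gt.
  exact: nbhs_right_lt.
- exact: interval_is_interval.
- move=> x /=; rewrite !in_itv /= lt_min => /and3P[ax -> xad].
  by rewrite ax ltr_distl xad (lt_trans _ ax)// ltrBlDr ltrDl.
Unshelve. all: by end_near. Qed.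

(** The endpoint value of an extended branch is its one-sided limit, so by uniqueness of limits the
    incidences counted here are those already counted by limits. *)
Lemma count_extended_branches_left a b y br : a < b ->
  extended_branches g a b br -> on_curve g b y -> ~ critical_point g b y ->
  count (fun f : R -> R => f b == y) br = 1%N.
Proof.
move=> ab [bbr ext] gby ncr; rewrite -(count_branches_at_left ab bbr gby ncr).
apply: eq_in_count => f /(nthP (fun=> 0))[k ks <-].
have [/(continuous_within_itvP _ ab)[_ _ cvgb] _ _] := ext (Ordinal ks).
apply/eqP/asboolP => [<-//|cvgy].
exact: (cvg_unique _ cvgb cvgy).
Qed.

Lemma count_extended_branches_right a b y br : a < b ->
  extended_branches g a b br -> on_curve g a y -> ~ critical_point g a y ->
  count (fun f : R -> R => f a == y) br = 1%N.
Proof.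
move=> ab [bbr ext] gay ncr; rewrite -(count_branches_at_right ab bbr gay ncr).
apply: eq_in_count => f /(nthP (fun=> 0))[k ks <-].
have [/(continuous_within_itvP _ ab)[_ cvga _] _ _] := ext (Ordinal ks).
apply/eqP/asboolP => [<-//|cvgy].
exact: (cvg_unique _ cvga cvgy).
Qed.

End Endpoints.

(** * From the curve to combinatorial data *)

(** Double counting: each [t] contributes to exactly one summand, the one at the index of [f t] in
    [vs]. It is applied to branches and their endpoints. *)
Lemma sum_count_eq (T : Type) (U : eqType) (f : T -> U) (u0 : U) (s : seq T)
    (vs : seq U) : uniq vs -> all (fun t => f t \in vs) s ->
  (\sum_(j < size vs) count (fun t => f t == nth u0 vs j) s = size s)%N.
Proof.
move=> us; elim: s => [|t s IHs] /=; first by rewrite big1.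
move=> /andP[tvs svs]; rewrite big_split /= IHs// -[in RHS]add1n; congr addn.
move: (tvs); rewrite -index_mem => ltt.
rewrite (bigD1 (Ordinal ltt))//= nth_index// eqxx big1// => j.
apply: contraNeq; rewrite -val_eqE /= eqb0 negbK => /eqP ->.
by rewrite index_uniq.
Qed.

Lemma real_roots_size_le (R : realType) (g : {poly {poly R}}) (x : R)
    (ys : seq R) : real_roots g x ys -> (size ys <= total_degree g)%N.
Proof.
move=> [/lt_sorted_uniq us rts].
have p_neq0 : g.[x%:P] != 0.
  (* If [g(x, -)] were zero, the finite list [ys] would have to contain [size ys + 1] distinct
     integers. *)
  apply/eqP => p0; pose s := [seq i%:R : R | i <- iota 0 (size ys).+1].
  suff: (size s <= size ys)%N by rewrite size_map size_iota ltnn.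
  apply: uniq_leq_size => [|y _]; last by rewrite rts p0 root0.
  by rewrite map_inj_uniq ?iota_uniq// => i j /eqP; rewrite eqr_nat => /eqP.
have allr : all (root g.[x%:P]) ys by apply/allP => y; rewrite rts.
rewrite -ltnS (leq_trans (max_poly_roots p_neq0 allr us))// horner_coef.
apply: (leq_trans (size_sum _ _ _)); apply/bigmax_leqP => i _.
rewrite -rmorphXn mulrC mul_polyC (leq_trans (size_scale_leq _ _))//.
have [->|gi0] := eqVneq g`_i 0; first by rewrite size_poly0.
have szi : (0 < size (g`_i)%R)%N by rewrite size_poly_gt0.
rewrite -(prednK szi) ltnS.
by rewrite /total_degree (bigD1 i)//= leq_max leq_addl.
Qed.

(** This interface between geometry and algorithm collects the facts about the curve on which both
    programs rely, free of real numbers. *)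
Record branch_data (n : nat) (r : nat -> nat) (L Rt : nat -> nat -> nat)
    (crit : nat -> nat -> bool) (d : nat) : Prop := {
  fiber_size : forall i, (i < n)%N -> (r i <= d)%N;
  regular_counts : forall i j, (i < n)%N -> (j < r i)%N -> ~~ crit i j ->
    L i j = 1%N /\ Rt i j = 1%N;
  counts_agree : forall i, (i.+1 < n)%N ->
    (\sum_(j < r i) Rt i j = \sum_(j < r i.+1) L i.+1 j)%N;
  critical_isolated : forall i j, (i < n)%N -> (j < r i)%N -> crit i j ->
    [/\ (0 < i)%N, (i.+1 < n)%N,
        forall k, (k < r i.-1)%N -> ~~ crit i.-1 k,
        forall k, (k < r i.+1)%N -> ~~ crit i.+1 k
      & forall k, (k < r i)%N -> crit i k -> k = j]
}.

Lemma sum_ones_but_one (m j : nat) (f : nat -> nat) : (j < m)%N ->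
  (forall k, (k < m)%N -> k != j -> f k = 1%N) ->
  (\sum_(k < m) f k + 1 = f j + m)%N.
Proof.
move=> jm f1; rewrite (bigD1 (Ordinal jm))//= (eq_bigr (fun=> 1%N)).
  rewrite sum1_card cardC1 card_ord -addnA addn1 prednK//.
  exact: leq_trans jm.
by move=> k; rewrite -val_eqE /=; exact: f1.
Qed.

Section BranchData.
Variables (n : nat) (r : nat -> nat) (L Rt : nat -> nat -> nat).
Variables (crit : nat -> nat -> bool) (d : nat).
Hypothesis bd : branch_data n r L Rt crit d.

Lemma sum_right_regular i : (i < n)%N ->
  (forall k, (k < r i)%N -> ~~ crit i k) -> (\sum_(k < r i) Rt i k = r i)%N.
Proof.
move=> ni reg; rewrite (eq_bigr (fun=> 1%N)) ?sum1_card ?card_ord// => k _.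
by have [] := regular_counts bd ni (ltn_ord k) (reg _ (ltn_ord k)).
Qed.

Lemma sum_left_regular i : (i < n)%N ->
  (forall k, (k < r i)%N -> ~~ crit i k) -> (\sum_(k < r i) L i k = r i)%N.
Proof.
move=> ni reg; rewrite (eq_bigr (fun=> 1%N)) ?sum1_card ?card_ord// => k _.
by have [] := regular_counts bd ni (ltn_ord k) (reg _ (ltn_ord k)).
Qed.

(** All other summands of the fiber are 1, and the total equals the size of the regular neighbouring
    fiber. The additive form avoids truncated subtraction in [nat]. *)
Lemma critical_counts i j : (i < n)%N -> (j < r i)%N -> crit i j ->
  (L i j + r i = r i.-1 + 1)%N /\ (Rt i j + r i = r i.+1 + 1)%N.
Proof.
move=> ni jr cr; have [i_gt0 Si regm regp uniqj] := critical_isolated bd ni jr cr.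
have reg k : (k < r i)%N -> k != j -> L i k = 1%N /\ Rt i k = 1%N.
  move=> kr kj; apply: (regular_counts bd) => //.
  by apply: contra kj => /(uniqj _ kr) ->.
split.
  rewrite -(@sum_ones_but_one _ _ (L i) jr); last first.
    by move=> k kr /(reg _ kr)[].
  have Pi : (i.-1.+1 < n)%N by rewrite prednK.
  have := counts_agree bd Pi; rewrite prednK// => <-.
  by rewrite sum_right_regular// (leq_ltn_trans (leq_pred i)).
rewrite -(@sum_ones_but_one _ _ (Rt i) jr); last first.
  by move=> k kr /(reg _ kr)[].
by rewrite (counts_agree bd Si) sum_left_regular.
Qed.

(** This serves twice: it bounds the number of edges over an interval by the size of a fiber, and it
    excludes multiple edges. *)
Lemma consecutive_fibers_regular i : (i.+1 < n)%N ->
  (forall k, (k < r i)%N -> ~~ crit i k) \/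
  (forall k, (k < r i.+1)%N -> ~~ crit i.+1 k).
Proof.
move=> Si; have [[j jr cr]|nocr] :=
    pselect (exists2 j, (j < r i)%N & crit i j).
  by right; have [] := critical_isolated bd (ltnW Si) jr cr.
by left=> k kr; apply/negP => cr; apply: nocr; exists k.
Qed.

Lemma sum_right_le i : (i.+1 < n)%N -> (\sum_(k < r i) Rt i k <= d)%N.
Proof.
move=> Si; have [reg|reg] := consecutive_fibers_regular Si.
  by rewrite sum_right_regular ?(fiber_size bd)// ltnW.
by rewrite (counts_agree bd Si) sum_left_regular ?(fiber_size bd).
Qed.

End BranchData.

(** Fiber sizes are bounded by the degree, regular counts come from the local analysis, agreement of
    sums from double counting of branch endpoints, and isolation of critical points from the good
    partition and general position. *)
Lemma branch_data_of_curve (R : realType) (g : {poly {poly R}}) (xs : seq R)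
    (ys : nat -> seq R) (br : nat -> seq (R -> R)) (a b : R)
    (brL brR : seq (R -> R)) :
  general_position g -> good_partition g xs ->
  (forall i : nat, (i < size xs)%N -> real_roots g xs`_i (ys i)) ->
  (forall i : nat, (i.+1 < size xs)%N ->
     extended_branches g xs`_i xs`_i.+1 (br i)) ->
  a < xs`_0 -> branches g a xs`_0 brL ->
  xs`_(size xs).-1 < b -> branches g xs`_(size xs).-1 b brR ->
  branch_data (size xs) (size \o ys) (left_half_branches xs ys br brL)
    (right_half_branches xs ys br brR)
    (fun i j => `[< critical_point g xs`_i (ys i)`_j >]) (total_degree g).
Proof.
move=> [_ _ crit_inj] [xs_sorted _ crit_xs] roots ext ax0 brLP xb brRP.
have on i j : (i < size xs)%N -> (j < size (ys i))%N ->
    on_curve g xs`_i (ys i)`_j.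
  move=> ni jr; apply/rootP; rewrite -(proj2 (roots i ni)).
  exact: mem_nth.
have mono i : (i.+1 < size xs)%N -> xs`_i < xs`_i.+1.
  by move=> Si; apply: (sortedP 0 xs_sorted).
split=> [i ni|i j ni jr|i Si|i j ni jr].
- exact: real_roots_size_le (roots i ni).
- move=> /asboolPn ncr; split; rewrite /left_half_branches /right_half_branches.
    (* Over the first abscissa the count uses limits of [brL]; elsewhere it uses endpoint values.
       The last abscissa is treated likewise with [brR]. *)
    case: i => [|i] in ni jr ncr *.
      by apply: (count_branches_at_left ax0 brLP) => //; exact: on.
    apply: (count_extended_branches_left (mono i ni) (ext i ni)) => //.
    exact: on.
  case: ifPn => [Si|].
    apply: (count_extended_branches_right (mono i Si) (ext i Si)) => //.
    exact: on.
  rewrite -leqNgt => nS; have iE : i = (size xs).-1.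
    by apply/eqP; rewrite -eqSS prednK ?(leq_ltn_trans _ ni)// eqn_leq ni.
  rewrite -iE in xb brRP.
  by apply: (count_branches_at_right xb brRP) => //; exact: on.
- rewrite /right_half_branches /left_half_branches Si /=.
  have ni : (i < size xs)%N by exact: ltnW.
  have [us rts] := roots i ni; have [us' rts'] := roots i.+1 Si.
  have incident := proj2 (ext i Si).
  rewrite (sum_count_eq (f := fun f : R -> R => f xs`_i)) ?lt_sorted_uniq//.
    rewrite (sum_count_eq (f := fun f : R -> R => f xs`_i.+1)) ?lt_sorted_uniq//.
    apply/(all_nthP (fun=> 0)) => k ks; rewrite rts'; apply/rootP.
    by have [] := incident (Ordinal ks).
  apply/(all_nthP (fun=> 0)) => k ks; rewrite rts; apply/rootP.
  by have [] := incident (Ordinal ks).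
- move=> /asboolP cr.
  have [|i' [i'_gt0 Si' xE regm regp]] := crit_xs xs`_i.
    by exists (ys i)`_j.
  (* The good partition yields some index with the same abscissa; strict ordering identifies it with
     [i]. *)
  have ii' : i = i'.
    apply/eqP; rewrite -(nth_uniq 0 ni _ (lt_sorted_uniq xs_sorted)) ?xE//.
    exact: ltnW.
  rewrite -ii' in i'_gt0 Si' regm regp; split=> //.
  + by move=> k _; apply/asboolPn => crk; apply: regm; exists (ys i.-1)`_k.
  + by move=> k _; apply/asboolPn => crk; apply: regp; exists (ys i.+1)`_k.
  + move=> k kr /asboolP crk; apply/eqP; apply: contrapT => /negP kj.
    apply: (crit_inj _ _ _ _ crk cr) => // -[] /eqP.
    rewrite nth_uniq// ?(negPf kj)//.
    by apply: lt_sorted_uniq; case: (roots i ni).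
Qed.

(** * Reasoning about programs and their cost *)

(** Total correctness in weakest-precondition style, with the cost as first argument of the
    postcondition, so that programs can be executed symbolically by the rules below. *)
Definition runs (c : cmd) (s : store) (Q : nat -> store -> Prop) : Prop :=
  exists k s', exec c s k s' /\ Q k s'.

Lemma runs_weaken c s (P Q : nat -> store -> Prop) :
  (forall k s', P k s' -> Q k s') -> runs c s P -> runs c s Q.
Proof. by move=> PQ [k [s' [e /PQ q]]]; exists k, s'. Qed.

Lemma runs_copy a i j o s (Q : nat -> store -> Prop) :
  Q 0%N (update s a (value s i) (value s j) (value s o)) ->
  runs (Copy a i j o) s Q.
Proof. by move=> q; do 2!eexists; split; [exact: ExecCopy|]. Qed.

Lemma runs_add a i j o1 o2 s (Q : nat -> store -> Prop) :
  Q 1%N (update s a (value s i) (value s j) (value s o1 + value s o2)) ->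
  runs (AddTo a i j o1 o2) s Q.
Proof. by move=> q; do 2!eexists; split; [exact: ExecAdd|]. Qed.

Lemma runs_sub a i j o1 o2 s (Q : nat -> store -> Prop) :
  Q 1%N (update s a (value s i) (value s j) (value s o1 - value s o2)) ->
  runs (SubTo a i j o1 o2) s Q.
Proof. by move=> q; do 2!eexists; split; [exact: ExecSub|]. Qed.

Lemma runs_seq c1 c2 s (Q : nat -> store -> Prop) :
  runs c1 s (fun k1 s1 => runs c2 s1 (fun k2 s2 => Q (k1 + k2)%N s2)) ->
  runs (Seq c1 c2) s Q.
Proof.
move=> [k1 [s1 [e1 [k2 [s2 [e2 q]]]]]].
by exists (k1 + k2)%N, s2; split; [exact: ExecSeq e1 e2|].
Qed.

Lemma runs_if o1 o2 c1 c2 s (Q : nat -> store -> Prop) :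
  (if value s o1 <= value s o2 then runs c1 s Q else runs c2 s Q) ->
  runs (IfLe o1 o2 c1 c2) s Q.
Proof.
by case: ifPn => le12 [k [s' [e q]]]; exists k, s'; split=> //;
  [exact: ExecIfTrue|exact: ExecIfFalse].
Qed.

(** [I t] is the invariant after [t] rounds and [N] the exact number of rounds, which settles
    termination. The induction on [N] peels off the first round and shifts [I] and [B]. *)
Lemma runs_while o1 o2 c (I : nat -> store -> Prop) (B : nat -> nat) N s :
  I 0%N s ->
  (forall t s1, (t < N)%N -> I t s1 -> value s1 o1 <= value s1 o2 /\
     runs c s1 (fun k s2 => (k <= B t)%N /\ I t.+1 s2)) ->
  (forall s1, I N s1 -> ~~ (value s1 o1 <= value s1 o2)) ->
  runs (WhileLe o1 o2 c) s (fun k s' => (k <= \sum_(t < N) B t)%N /\ I N s').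
Proof.
elim: N I B s => [|N IHN] I B s I0 step stop.
  exists 0%N, s; split; last by rewrite big_ord0.
  by apply: ExecWhileFalse; exact: stop.
have [le12 [k1 [s1 [e1 [k1B I1]]]]] := step 0%N s isT I0.
have [|k2 [s2 [e2 [k2B I2]]]] :=
  IHN (fun t => I t.+1) (fun t => B t.+1) s1 I1 _ stop.
  by move=> t s3 tN; exact: step.
exists (k1 + k2)%N, s2; split; first exact: ExecWhileTrue le12 e1 e2.
by rewrite big_ord_recl leq_add.
Qed.

Lemma update_eq s a i j v : update s a i j v a i j = v.
Proof. by rewrite /update !eqxx. Qed.

Lemma update_other s a i j v a' : a' != a -> update s a i j v a' = s a'.
Proof.
by move=> /negPf neq; apply/funext => i'; apply/funext => j'; rewrite /update neq.
Qed.

(* Scratch arrays: arr_i holds the current fiber i, i + 1 and i - 1 (arbitrary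
   for i = 0, a fiber without critical points), arr_j the current point j and
   j + 1, arr_t everything else. *)
Definition arr_i : nat := 7.
Definition arr_j : nat := 8.
Definition arr_t : nat := 9.

Definition var_i := Cell arr_i (Lit 0) (Lit 0).
Definition var_next_i := Cell arr_i (Lit 1) (Lit 0).
Definition var_prev_i := Cell arr_i (Lit 2) (Lit 0).
Definition var_j := Cell arr_j (Lit 0) (Lit 0).
Definition var_next_j := Cell arr_j (Lit 1) (Lit 0).
Definition var_t := Cell arr_t (Lit 0) (Lit 0).
Definition var_last := Cell arr_t (Lit 1) (Lit 0).
Definition var_m := Cell arr_m (Lit 0) (Lit 0).
Definition var_n := Cell arr_n (Lit 0) (Lit 0).

(** Keeping [j + 1] in a cell expresses [j < r] by the only available test and limits the counter to
    one addition per round. *)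
Definition for_points (body : cmd) : cmd :=
  Seq (Copy arr_j (Lit 0) (Lit 0) (Lit 0))
  (Seq (Copy arr_j (Lit 1) (Lit 0) (Lit 1))
  (WhileLe var_next_j (Cell arr_r var_i (Lit 0))
    (Seq body
    (Seq (Copy arr_j (Lit 0) (Lit 0) var_next_j)
         (AddTo arr_j (Lit 1) (Lit 0) var_next_j (Lit 1)))))).

Definition for_fibers (lo : nat) (lim : operand) (body : cmd) : cmd :=
  Seq (Copy arr_i (Lit 0) (Lit 0) (Lit lo%:Z))
  (Seq (Copy arr_i (Lit 1) (Lit 0) (Lit lo.+1%:Z))
  (WhileLe var_next_i lim
    (Seq body
    (Seq (Copy arr_i (Lit 2) (Lit 0) var_i)
    (Seq (Copy arr_i (Lit 0) (Lit 0) var_next_i)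
         (AddTo arr_i (Lit 1) (Lit 0) var_next_i (Lit 1))))))).

(** The invariant must be insensitive to [arr_j], which the loop itself writes. The [+ 1] in the
    bound pays for the counter. *)
Lemma runs_for_points body (I : nat -> store -> Prop) (B : nat -> nat) N s :
  s arr_r (s arr_i 0 0) 0 = N%:Z ->
  (forall t s1 s2, (forall a, a != arr_j -> s2 a = s1 a) -> I t s1 -> I t s2) ->
  I 0%N s ->
  (forall t s1, (t < N)%N -> I t s1 -> s1 arr_i = s arr_i ->
     s1 arr_j 0 0 = t%:Z ->
     runs body s1 (fun k s2 => [/\ (k <= B t)%N, I t.+1 s2,
       s2 arr_i = s1 arr_i, s2 arr_r = s1 arr_r & s2 arr_j = s1 arr_j])) ->
  runs (for_points body) s (fun k s' => [/\ (k <= \sum_(t < N) (B t + 1))%N,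
    I N s' & s' arr_i = s arr_i]).
Proof.
move=> rN I_off I0 step; do 2![apply: runs_seq; apply: runs_copy].
set s1 := update _ _ _ _ _.
pose J t s' := [/\ I t s', s' arr_i = s arr_i, s' arr_r = s arr_r,
  s' arr_j 0 0 = t%:Z & s' arr_j 1 0 = t.+1%:Z].
apply: (@runs_weaken _ _ (fun k s' =>
    (k <= \sum_(t < N) (B t + 1))%N /\ J N s')).
  by move=> k s' [kB [IN E _ _ _]].
apply: (@runs_while _ _ _ J (fun t => B t + 1)%N) => [|t s2 tN [It Ei Er Ej Ej1]|s2 [_ Ei Er _ Ej1]].
- split=> //; apply: I_off I0 => a aj; rewrite /s1 !update_other//.
- split; first by rewrite /= Ej1 Er Ei rN lez_nat.
  apply: runs_seq; have := step t s2 tN It Ei Ej.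
  apply: runs_weaken => k s3 [kB It' Ei' Er' Ej'].
  apply: runs_seq; apply: runs_copy; apply: runs_add.
  split; first by rewrite addn1 leq_add2r.
  split.
  + by apply: I_off It' => a aj; rewrite !update_other.
  + by rewrite !update_other ?Ei'.
  + by rewrite !update_other ?Er'.
  + by rewrite /update /= Ej' Ej1.
  + by rewrite /update /= Ej' Ej1 addrC -intS.
- by rewrite /= Ej1 Er Ei rN lez_nat ltnn.
Qed.

Lemma runs_for_fibers lo lim body (I : nat -> store -> Prop) (B : nat -> nat)
    N s :
  (forall t s1 s2, (forall a, a != arr_i -> s2 a = s1 a) -> I t s1 -> I t s2) ->
  (forall t s1, I t s1 -> value s1 lim = (lo + N)%:Z) ->
  I 0%N s ->
  (forall t s1, (t < N)%N -> I t s1 -> s1 arr_i 0 0 = (lo + t)%:Z ->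
     s1 arr_i 1 0 = (lo + t).+1%:Z ->
     ((0 < t)%N -> s1 arr_i 2 0 = (lo + t).-1%:Z) ->
     runs body s1 (fun k s2 => [/\ (k <= B t)%N, I t.+1 s2 &
       s2 arr_i = s1 arr_i])) ->
  runs (for_fibers lo lim body) s
    (fun k s' => (k <= \sum_(t < N) (B t + 1))%N /\ I N s').
Proof.
move=> I_off I_lim I0 step; do 2![apply: runs_seq; apply: runs_copy].
set s1 := update _ _ _ _ _.
pose J t s' := [/\ I t s', s' arr_i 0 0 = (lo + t)%:Z,
  s' arr_i 1 0 = (lo + t).+1%:Z &
  ((0 < t)%N -> s' arr_i 2 0 = (lo + t).-1%:Z)].
apply: (@runs_weaken _ _ (fun k s' =>
    (k <= \sum_(t < N) (B t + 1))%N /\ J N s')).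
  by move=> k s' [kB [IN _ _ _]].
apply: (@runs_while _ _ _ J (fun t => B t + 1)%N) => [|t s2 tN [It Ei Ei1 Ei2]|s2 [IN _ Ei1 _]].
- split=> //; try by rewrite addn0.
  by apply: I_off I0 => a ai; rewrite /s1 !update_other.
- split; first by rewrite (I_lim _ _ It) /= Ei1 lez_nat ltn_add2l.
  apply: runs_seq; have := step t s2 tN It Ei Ei1 Ei2.
  apply: runs_weaken => k s3 [kB It' Ei'].
  do 2![apply: runs_seq; apply: runs_copy]; apply: runs_add.
  split; first by rewrite addn1 leq_add2r.
  split.
  + by apply: I_off It' => a ai; rewrite !update_other.
  + by rewrite /update /= Ei' Ei1 addnS.
  + by rewrite /update /= Ei' Ei1 addnS addrC -intS.
  + by rewrite /update /= Ei' Ei addnS.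
- by rewrite (I_lim _ _ IN) /= Ei1 lez_nat ltnn.
Qed.

(** * The two programs, and correctness of Step 3 *)

Definition critical_count (a : nat) (neighbour : operand) : cmd :=
  Seq (SubTo a var_i var_j (Cell arr_r neighbour (Lit 0))
         (Cell arr_r var_i (Lit 0)))
      (AddTo a var_i var_j (Cell a var_i var_j) (Lit 1)).

Definition count_half_branches : cmd :=
  for_fibers 0 var_n (for_points
    (IfLe (Cell arr_crit var_i var_j) (Lit 0)
      (Seq (Copy arr_L var_i var_j (Lit 1)) (Copy arr_R var_i var_j (Lit 1)))
      (Seq (critical_count arr_L var_prev_i)
           (critical_count arr_R var_next_i)))).

(** One pass fills two columns of the edge table, repeating each point as often as its count. The
    row counter is [arr_m] itself, so it ends as the number of edges. The inner counter starts at 1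
    because the test is [<=]. *)
Definition list_stubs (counts col lo : nat) (lim : operand) : cmd :=
  Seq (Copy arr_m (Lit 0) (Lit 0) (Lit 0))
  (for_fibers lo lim (for_points
    (Seq (Copy arr_t (Lit 0) (Lit 0) (Lit 1))
    (WhileLe var_t (Cell counts var_i var_j)
      (Seq (Copy arr_E var_m (Lit col%:Z) var_i)
      (Seq (Copy arr_E var_m (Lit col.+1%:Z) var_j)
      (Seq (AddTo arr_m (Lit 0) (Lit 0) var_m (Lit 1))
           (AddTo arr_t (Lit 0) (Lit 0) var_t (Lit 1))))))))).

(** Right stubs are taken over all fibers but the last, left stubs over all but the first; equal
    ranks meet in the same row. *)
Definition connect_points : cmd :=
  Seq (SubTo arr_t (Lit 1) (Lit 0) var_n (Lit 1))
  (Seq (list_stubs arr_R 0 0 var_last) (list_stubs arr_L 2 1 var_n)).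

(** This is [has_input] with the curve replaced by abstract fiber sizes and flags. *)
Definition holds_input (n : nat) (r : nat -> nat) (crit : nat -> nat -> bool)
    (s : store) : Prop :=
  s arr_n 0 0 = n%:Z /\
  forall i : nat, (i < n)%N ->
    s arr_r i%:Z 0 = (r i)%:Z /\
    forall j : nat, (j < r i)%N ->
      s arr_crit i%:Z j%:Z = if crit i j then 1 else 0.

Lemma holds_input_eq n r crit s1 s2 : (forall a, (a < 3)%N -> s2 a = s1 a) ->
  holds_input n r crit s1 -> holds_input n r crit s2.
Proof. by move=> E; rewrite /holds_input !E. Qed.

(** A point costs at most 5: two operations for each of the two formulas and one for the counter. A
    fiber costs one more. The invariants say that the finished fibers ([I]) and the finished points
    of the current fiber ([J]) carry correct counts. *)
Lemma runs_count_half_branches n r L Rt crit d s :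
  branch_data n r L Rt crit d -> holds_input n r crit s ->
  runs count_half_branches s (fun k s' =>
    [/\ (k <= n * (5 * d + 1))%N, holds_input n r crit s'
      & has_counts n r L Rt s']).
Proof.
move=> bd inp.
pose done_at s' i j := s' arr_L i%:Z j%:Z = (L i j)%:Z /\
  s' arr_R i%:Z j%:Z = (Rt i j)%:Z.
pose I t s' := holds_input n r crit s' /\
  (forall i j, (i < t)%N -> (j < r i)%N -> done_at s' i j).
have I_eq t s1 s2 : (forall a, (a < 5)%N -> s2 a = s1 a) -> I t s1 -> I t s2.
  move=> E [inp1 I1]; split.
    by apply: holds_input_eq inp1 => a a3; apply: E; apply: ltn_trans a3 _.
  by rewrite /done_at !E.
apply: (@runs_weaken _ _ (fun k s' =>
    (k <= \sum_(i < n) (\sum_(j < r i) (4 + 1) + 1))%N /\ I n s')).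
  move=> k s' [kB [inp' IN]]; split=> //.
  apply: leq_trans kB _; rewrite -[X in (_ <= X * _)%N]card_ord -sum_nat_const.
  apply: leq_sum => i _; rewrite leq_add2r sum_nat_const card_ord mulnC leq_mul2l.
  exact: (fiber_size bd).
apply: (@runs_for_fibers _ _ _ I
    (fun i => \sum_(j < r i) (4 + 1))%N) => [t s1 s2 E|t s1 []||t s1 tn It].
- by apply: I_eq => a a5; apply: E; case: a a5 => [|[|[|[|[|]]]]].
- by move=> [].
- by split.
rewrite add0n => Ei Ei1 Ei2.
pose J t' s' := I t s' /\ forall j, (j < t')%N -> done_at s' t j.
apply: (@runs_weaken _ _ (fun k s' => [/\ (k <= \sum_(j < r t) (4 + 1))%N,
    J (r t) s' & s' arr_i = s1 arr_i])).
  move=> k s' [kB [[inp' It'] Jt] Ei']; split=> //; split=> // i j.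
  rewrite ltnS leq_eqVlt => /predU1P[-> jr|it jr]; first exact: Jt.
  exact: It'.
apply: (@runs_for_points _ J (fun=> 4%N)).
- by rewrite Ei; case: It => -[_ /(_ t tn)[]].
- move=> t' s2 s3 E [It' Jt'].
  have E' a : (a < 5)%N -> s3 a = s2 a.
    by move=> a5; apply: E; case: a a5 => [|[|[|[|[|]]]]].
  by split; [exact: I_eq It'|rewrite /done_at !E'].
- by split.
move=> j s2 jr [It' Jj] Ei' Ej; apply: runs_if.
have [[_ inpi] _] := It'; have [rt crt] := inpi t tn.
rewrite /= Ei' Ei Ej crt//.
have J_next s3 : (forall a, a != arr_L -> a != arr_R -> s3 a = s2 a) ->
    (forall a i' j', (i', j') != (t%:Z, j%:Z) -> s3 a i' j' = s2 a i' j') ->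
    done_at s3 t j -> J j.+1 s3.
  move=> off off' done_tj; split; first split.
  - apply: holds_input_eq (proj1 It') => a a3.
    by apply: off; case: a a3 => [|[|[|]]].
  - move=> i k it kr; rewrite /done_at !off'; first exact: (proj2 It').
      by rewrite xpair_eqE eqz_nat (ltn_eqF it).
    by rewrite xpair_eqE eqz_nat (ltn_eqF it).
  move=> k; rewrite ltnS leq_eqVlt => /predU1P[->//|kj].
  rewrite /done_at !off'; first exact: Jj.
    by rewrite xpair_eqE !eqz_nat (ltn_eqF kj) andbF.
  by rewrite xpair_eqE !eqz_nat (ltn_eqF kj) andbF.
case crtj: (crit t j).
  have [Lc Rc] := critical_counts bd tn jr crtj.
  (* A critical fiber is neither first nor last, so the cell for [i - 1] is meaningful and both
     neighbouring sizes are part of the input. *)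
  have [t_gt0 St _ _ _] := critical_isolated bd tn jr crtj.
  have [rp _] := inpi t.-1 (leq_ltn_trans (leq_pred t) tn).
  have [rn _] := inpi t.+1 St.
  rewrite ler10; apply: runs_seq; apply: runs_seq; apply: runs_sub; apply: runs_add.
  apply: runs_seq; apply: runs_sub; apply: runs_add.
  rewrite /= !(update_other, update_eq)// !Ei' Ei Ej Ei1 (Ei2 t_gt0).
  rewrite rt rp rn; split=> //.
  apply: J_next.
  - by move=> a aL aR; rewrite !update_other.
  - by move=> a i' j'; rewrite /update xpair_eqE => /negPf ->; rewrite !andbF.
  - by split; rewrite /update /= !eqxx /=; lia.
have [L1 R1] := regular_counts bd tn jr (negbT crtj).
rewrite lexx; apply: runs_seq; apply: runs_copy; apply: runs_copy.
rewrite /= ?(update_other, Ei', Ei, Ej)//; split=> //.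
apply: J_next.
- by move=> a aL aR; rewrite !update_other.
- by move=> a i' j'; rewrite /update xpair_eqE => /negPf ->; rewrite !andbF.
- by split; rewrite /update /= !eqxx /= ?L1 ?R1.
Qed.

(** * Stubs and their joining by rank *)

(** A stub is an edge end awaiting its partner: a vertex repeated once for each of its half-branches
    on one side. *)
Definition fiber_stubs (cnt : nat -> nat) (i m : nat) : seq vertex :=
  flatten [seq nseq (cnt j) (i, j) | j <- iota 0 m].

Definition stubs (cnt : nat -> nat -> nat) (r : nat -> nat) (lo N : nat) :
    seq vertex :=
  flatten [seq fiber_stubs (cnt i) i (r i) | i <- iota lo N].

Lemma fiber_stubsS cnt i m :
  fiber_stubs cnt i m.+1 = fiber_stubs cnt i m ++ nseq (cnt m) (i, m).
Proof.
by rewrite /fiber_stubs -addn1 iotaD map_cat flatten_cat /= cats0.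
Qed.

Lemma stubsS cnt r lo N : stubs cnt r lo N.+1 =
  stubs cnt r lo N ++ fiber_stubs (cnt (lo + N)%N) (lo + N) (r (lo + N)%N).
Proof.
by rewrite /stubs -addn1 iotaD map_cat flatten_cat /= cats0.
Qed.

Lemma size_fiber_stubs cnt i m : size (fiber_stubs cnt i m) = (\sum_(j < m) cnt j)%N.
Proof.
by elim: m => [|m IHm]; rewrite ?big_ord0// fiber_stubsS size_cat IHm size_nseq
  big_ord_recr.
Qed.

Lemma mem_fiber_stubs cnt i m v :
  v \in fiber_stubs cnt i m -> v.1 = i /\ (v.2 < m)%N.
Proof.
elim: m => // m IHm; rewrite fiber_stubsS mem_cat => /orP[/IHm[-> /ltnW]//|].
by rewrite mem_nseq => /andP[_ /eqP ->].
Qed.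

Lemma count_fiber_stubs cnt i m v : count_mem v (fiber_stubs cnt i m) =
  if (v.1 == i) && (v.2 < m)%N then cnt v.2 else 0%N.
Proof.
elim: m => [|m IHm]; first by rewrite andbF.
rewrite fiber_stubsS count_cat IHm count_nseq ltnS [in RHS]leq_eqVlt /= {IHm}.
case: v => i' j' /=; rewrite xpair_eqE [i == _]eq_sym [m == _]eq_sym.
have [_|_] := eqVneq i' i => //=.
by have [->|_] := eqVneq j' m; rewrite ?ltnn ?mul1n ?mul0n ?addn0.
Qed.

Lemma count_stubs cnt r lo N v : count_mem v (stubs cnt r lo N) =
  if [&& lo <= v.1, v.1 < lo + N & v.2 < r v.1]%N then cnt v.1 v.2 else 0%N.
Proof.
elim: N => [|N IHN]; first by rewrite addn0; case: ltngtP.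
rewrite stubsS count_cat IHN count_fiber_stubs addnS ltnS.
have [->|vN] := eqVneq v.1 (lo + N)%N.
  by rewrite ltnn leqnn leq_addr !andbF add0n.
by rewrite addn0 [(v.1 <= _)%N]leq_eqVlt (negPf vN).
Qed.

Lemma uniq_fiber_stubs cnt i m : (forall j, (j < m)%N -> cnt j = 1%N) ->
  uniq (fiber_stubs cnt i m).
Proof.
move=> cnt1; rewrite /fiber_stubs.
have /eq_in_map -> : {in iota 0 m, (fun j => nseq (cnt j) (i, j)) =1
    (fun j => [:: (i, j)])} by move=> j; rewrite mem_iota => /cnt1 ->.
by rewrite flatten_map1 map_inj_uniq ?iota_uniq// => j k [].
Qed.

(** Zipping interval by interval makes the adjacency of fibers visible, whereas the program produces
    two global lists; [unzip_stub_edges] reconciles the two views. *)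
Definition stub_edges (r : nat -> nat) (L Rt : nat -> nat -> nat) (N : nat) :
    seq edge :=
  flatten [seq zip (fiber_stubs (Rt i) i (r i))
                   (fiber_stubs (L i.+1) i.+1 (r i.+1)) | i <- iota 0 N].

Lemma stub_edgesS r L Rt N : stub_edges r L Rt N.+1 = stub_edges r L Rt N ++
  zip (fiber_stubs (Rt N) N (r N)) (fiber_stubs (L N.+1) N.+1 (r N.+1)).
Proof.
by rewrite /stub_edges -[in LHS]addn1 iotaD map_cat flatten_cat /= cats0.
Qed.

Lemma mem_zip (T U : eqType) (s : seq T) (t : seq U) p :
  p \in zip s t -> p.1 \in s /\ p.2 \in t.
Proof.
elim: s t => [|x s IHs] [|y t]//; rewrite !inE => /predU1P[->|/IHs[-> ->]].
  by rewrite !eqxx.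
by rewrite !orbT.
Qed.

Section Edges.
Variables (n : nat) (r : nat -> nat) (L Rt : nat -> nat -> nat).
Variables (crit : nat -> nat -> bool) (d : nat).
Hypothesis bd : branch_data n r L Rt crit d.

Let size_agree i : (i.+1 < n)%N -> size (fiber_stubs (Rt i) i (r i)) =
  size (fiber_stubs (L i.+1) i.+1 (r i.+1)).
Proof. by move=> Si; rewrite !size_fiber_stubs (counts_agree bd). Qed.

(** The two blocks over each interval have equal length, so zipping truncates nothing. *)
Lemma unzip_stub_edges N : (N < n)%N ->
  unzip1 (stub_edges r L Rt N) = stubs Rt r 0 N /\
  unzip2 (stub_edges r L Rt N) = stubs L r 1 N.
Proof.
elim: N => // N IHN Nn; have [E1 E2] := IHN (ltnW Nn).
split; rewrite stub_edgesS [LHS]map_cat stubsS -?E1 -?E2; congr cat.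
  by apply: unzip1_zip; rewrite size_agree.
by apply: unzip2_zip; rewrite size_agree.
Qed.

Lemma mem_stub_edges N e : e \in stub_edges r L Rt N ->
  [/\ (e.1.1 < N)%N, (e.1.2 < r e.1.1)%N, e.2.1 = e.1.1.+1
    & (e.2.2 < r e.2.1)%N].
Proof.
elim: N => // N IHN; rewrite stub_edgesS mem_cat => /orP[/IHN[/ltnW]//|].
by move=> /mem_zip[/mem_fiber_stubs[-> ?] /mem_fiber_stubs[-> ?]].
Qed.

Lemma uniq_stub_edges N : (N < n)%N -> uniq (stub_edges r L Rt N).
Proof.
elim: N => // N IHN Nn; rewrite stub_edgesS cat_uniq IHN ?(ltnW Nn)//=.
apply/andP; split.
  (* Edges over different intervals start over different fibers. *)
  apply/hasPn => e /mem_zip[/mem_fiber_stubs[eN _] _].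
  by apply/negP => /mem_stub_edges[]; rewrite eN ltnn.
(* One of the two fibers has no critical point, hence no multiple edges. *)
have [reg|reg] := consecutive_fibers_regular bd Nn.
  apply: zip_uniql; apply: uniq_fiber_stubs => j jr.
  by have [] := regular_counts bd (ltnW Nn) jr (reg j jr).
apply: zip_uniqr; apply: uniq_fiber_stubs => j jr.
by have [] := regular_counts bd Nn jr (reg j jr).
Qed.

(** The edges at a vertex on one side correspond to its occurrences in one projection, which is a
    stub list with known multiplicities. The [n] fibers bound [n.-1] intervals. *)
Lemma stub_edges_obey : (0 < n)%N ->
  obeys_branch_counts n r L Rt (stub_edges r L Rt n.-1).
Proof.
move=> n_gt0; have n1 : (n.-1 < n)%N by rewrite prednK.
have [E1 E2] := unzip_stub_edges n1.
split=> [|e /mem_stub_edges[e1 e2 e3 e4]|v /andP[v1 v2] Sv|v /andP[v1 v2] v_gt0].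
- exact: uniq_stub_edges.
- have Si : (e.1.1.+1 < n)%N by rewrite -ltn_predRL.
  by split=> //=; rewrite ?e2 ?e4 ?e3 andbT ?Si// ltnW.
- rewrite -(count_map fst (pred1 v)) [map _ _]E1 count_stubs v2.
  by rewrite (_ : (v.1 < 0 + n.-1)%N)//; lia.
- rewrite -(count_map snd (pred1 v)) [map _ _]E2 count_stubs v2 v_gt0.
  by rewrite (_ : (v.1 < 1 + n.-1)%N)//; lia.
Qed.

End Edges.

(** * Correctness and cost of Step 4 *)

Definition written (col : nat) (l : seq vertex) (s : store) : Prop :=
  s arr_m 0 0 = (size l)%:Z /\
  forall k : nat, (k < size l)%N ->
    s arr_E k%:Z col%:Z = (nth (0, 0)%N l k).1%:Z /\
    s arr_E k%:Z col.+1%:Z = (nth (0, 0)%N l k).2%:Z.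

(** Frame condition of a pass: it preserves the input and the counts (arrays below 5), the stored
    loop limit, and the columns of the other pass. *)
Definition untouched (col : nat) (s s' : store) : Prop :=
  [/\ forall a, (a < 5)%N -> s' a = s a, s' arr_t 1 0 = s arr_t 1 0
    & forall k c : int, c != col%:Z -> c != col.+1%:Z ->
        s' arr_E k c = s arr_E k c].

Lemma written_eq col l s1 s2 :
  s2 arr_m = s1 arr_m -> s2 arr_E = s1 arr_E ->
  written col l s1 -> written col l s2.
Proof. by move=> Em EE; rewrite /written Em EE. Qed.

Lemma untouched_eq col s s1 s2 :
  (forall a, (a < 5)%N -> s2 a = s1 a) -> s2 arr_t 1 0 = s1 arr_t 1 0 ->
  s2 arr_E = s1 arr_E -> untouched col s s1 -> untouched col s s2.
Proof.
move=> E Et EE [U1 U2 U3]; split=> [a a5||k c].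
- by rewrite E ?U1.
- by rewrite Et.
- by rewrite EE; exact: U3.
Qed.

(** Three nested invariants follow the table: [I] by fibers, [J] by points, [K] by copies of the
    current point. A copy costs two additions, one for the row counter and one for the inner
    counter; each point and each fiber adds one. *)
Lemma runs_list_stubs counts col lo lim N cnt r s : (counts < 5)%N ->
  (forall s', untouched col s s' -> value s' lim = (lo + N)%:Z) ->
  (forall t, (t < N)%N -> s arr_r (lo + t)%:Z 0 = (r (lo + t)%N)%:Z) ->
  (forall t j, (t < N)%N -> (j < r (lo + t))%N ->
     s counts (lo + t)%:Z j%:Z = (cnt (lo + t)%N j)%:Z) ->
  runs (list_stubs counts col lo lim) s (fun k s' =>
    [/\ (k <= \sum_(t < N) (\sum_(j < r (lo + t)) (cnt (lo + t) j * 2 + 1) + 1))%N,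
        written col (stubs cnt r lo N) s' & untouched col s s']).
Proof.
move=> counts5 lim_val r_val cnt_val; apply: runs_seq; apply: runs_copy.
set s1 := update _ _ _ _ _.
pose I t s' := written col (stubs cnt r lo t) s' /\ untouched col s s'.
apply: (@runs_weaken _ _ (fun k s' => (k <= \sum_(t < N)
    (\sum_(j < r (lo + t)) (cnt (lo + t) j * 2 + 1) + 1))%N /\ I N s')).
  by move=> k s' [kB [w u]].
apply: (@runs_for_fibers _ _ _ I
  (fun t => \sum_(j < r (lo + t)) (cnt (lo + t) j * 2 + 1))%N) =>
    [t s2 s3 E [w u]|t s2 [_ u]||t s2 tN [w u] Ei _ _].
- split; first by apply: written_eq w; exact: E.
  apply: untouched_eq u => [a a5||]; rewrite E//.
  by case: a a5 => [|[|[|[|[|]]]]].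
- exact: lim_val.
- split.
    by split=> //; rewrite /s1 update_eq.
  by split=> [a a5||k c _ _]; rewrite /s1 update_other//; case: a a5 => [|[|[|[|[|]]]]].
pose J j s' := written col
  (stubs cnt r lo t ++ fiber_stubs (cnt (lo + t)%N) (lo + t) j) s' /\
  untouched col s s'.
apply: (@runs_weaken _ _ (fun k s' =>
    [/\ (k <= \sum_(j < r (lo + t)) (cnt (lo + t) j * 2 + 1))%N,
        J (r (lo + t)%N) s' & s' arr_i = s2 arr_i])).
  by move=> k s' [kB [w' u'] Ei']; split=> //; split=> //; rewrite stubsS.
apply: (@runs_for_points _ J (fun j => cnt (lo + t) j * 2)%N).
- by case: u => U _ _; rewrite Ei U ?r_val.
- move=> j s3 s4 E [w' u']; split; first by apply: written_eq w'; exact: E.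
  apply: untouched_eq u' => [a a5||]; rewrite E//.
  by case: a a5 => [|[|[|[|[|]]]]].
- by split=> //; rewrite /fiber_stubs cats0.
move=> j s3 jr [w' u'] Ei' Ej; apply: runs_seq; apply: runs_copy.
pose K x s' := [/\ written col (stubs cnt r lo t ++
    fiber_stubs (cnt (lo + t)%N) (lo + t) j ++ nseq x ((lo + t)%N, j)) s',
  untouched col s s', s' arr_t 0 0 = x.+1%:Z, s' arr_i = s3 arr_i
  & s' arr_j = s3 arr_j].
set s4 := update _ _ _ _ _.
apply: (@runs_weaken _ _ (fun k s' =>
    (k <= \sum_(x < cnt (lo + t) j) 2)%N /\ K (cnt (lo + t)%N j) s')).
  move=> k s' [kB [w5 u5 _ -> ->]]; split=> //.
  - by move: kB; rewrite sum_nat_const card_ord.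
  - by split=> //; rewrite fiber_stubsS.
  - by case: u5 u' => [U5 _ _] [U _ _]; rewrite (U5 arr_r) ?(U arr_r).
have cnt_j s' : untouched col s s' -> s' arr_i = s3 arr_i ->
    s' arr_j = s3 arr_j ->
    value s' (Cell counts var_i var_j) = (cnt (lo + t)%N j)%:Z.
  by move=> [U _ _] Ei5 Ej5; rewrite /= Ei5 Ei' Ei Ej5 Ej U// cnt_val.
apply: (@runs_while _ _ _ K (fun=> 2%N)) =>
    [|x s5 xc [w5 u5 Et Ei5 Ej5]|s5 [_ u5 Et Ei5 Ej5]].
- split; rewrite /= ?cats0 /s4 ?update_eq ?update_other//.
  apply: untouched_eq u' => [a a5||]; last by rewrite update_other.
    by rewrite update_other//; case: a a5 => [|[|[|[|[|]]]]].
  by rewrite /update.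
- rewrite cnt_j// /var_t /= Et lez_nat; split=> //.
  do 2![apply: runs_seq; apply: runs_copy]; apply: runs_seq; apply: runs_add.
  apply: runs_add; split=> //.
  have [m5 e5] := w5; rewrite /= !update_other// Ei5 Ej5 Ei' Ej Ei Et m5.
  set l := _ ++ _ in m5 e5 *.
  (* One more copy appends one row, so only the last row differs from the previous invariant. *)
  have El : stubs cnt r lo t ++ fiber_stubs (cnt (lo + t)%N) (lo + t) j ++
      nseq x.+1 ((lo + t)%N, j) = rcons l ((lo + t)%N, j).
    by rewrite /l -cats1 -!catA -[in LHS]addn1 nseqD.
  split.
  + rewrite El; split; first by rewrite /update /= size_rcons addrC -intS.
    move=> k; rewrite size_rcons ltnS nth_rcons leq_eqVlt => /predU1P[->|kl].
      rewrite ltnn eqxx /update /= !eqxx /= eqz_nat.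
      by rewrite ltn_eqF.
    rewrite kl /update /= !eqz_nat (ltn_eqF kl) /=; exact: e5.
  + case: u5 => U1 U2 U3; split.
    * by move=> a a5; rewrite !update_other ?U1//; case: a a5 => [|[|[|[|[|]]]]].
    * by rewrite /update.
    * move=> k c /negPf c1 /negPf c2.
      by rewrite /update /= c1 c2 !andbF; apply: U3; rewrite ?c1 ?c2.
  + by rewrite /update /= addrC -intS.
  + by rewrite !update_other.
  + by rewrite !update_other.
- by rewrite cnt_j// /var_t /= Et lez_nat ltnn.
Qed.

(** Per fiber, at most [d] stubs cost 2 each, at most [d] points cost 1 each, and the fiber counter
    costs 1. *)
Lemma stub_cost_le (N lo d : nat) (cnt : nat -> nat -> nat) (r : nat -> nat) :
  (forall t, (t < N)%N -> (r (lo + t) <= d)%N) ->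
  (forall t, (t < N)%N -> (\sum_(j < r (lo + t)) cnt (lo + t) j <= d)%N) ->
  (\sum_(t < N) (\sum_(j < r (lo + t)) (cnt (lo + t) j * 2 + 1) + 1) <=
    N * (3 * d + 1))%N.
Proof.
move=> r_le cnt_le; rewrite -[X in (_ <= X * _)%N]card_ord -sum_nat_const.
apply: leq_sum => t _; rewrite leq_add2r big_split /= -big_distrl /=.
rewrite sum1_card card_ord.
rewrite (_ : 3 * d = d * 2 + d)%N; last by lia.
by rewrite leq_add ?leq_mul2r/= ?cnt_le ?r_le.
Qed.

Lemma runs_connect_points n r L Rt crit d s : (0 < n)%N ->
  branch_data n r L Rt crit d -> holds_input n r crit s ->
  has_counts n r L Rt s ->
  runs connect_points s (fun k s' => (k <= 1 + n * (6 * d + 2))%N /\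
    has_edges (stub_edges r L Rt n.-1) s').
Proof.
move=> n_gt0 bd [inp_n inp] counts.
apply: runs_seq; apply: runs_sub; apply: runs_seq.
set s1 := update _ _ _ _ _.
have s1E a : (a < 5)%N -> s1 a = s a.
  by move=> a5; rewrite /s1 update_other//; case: a a5 => [|[|[|[|[|]]]]].
have := @runs_list_stubs arr_R 0 0 var_last n.-1 Rt r s1 isT _ _ _.
case=> [s' [_ /= -> _]|t tn|t j tn jr|k1 [s2 [e2 [k1B [_ row1] [U1 _ U2]]]]].
- by rewrite /s1 /update /= inp_n add0n; lia.
- rewrite s1E//; have [] := inp (0 + t)%N _ => //; lia.
- by rewrite s1E//; have [|] := counts (0 + t)%N j _ jr; lia.
exists k1, s2; split=> //.
have := @runs_list_stubs arr_L 2 1 var_n n.-1 L r s2 isT _ _ _.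
case=> [s' [U3 _ _]|t tn|t j tn jr|k2 [s3 [e3 [k2B [m3 row3] [_ _ U3]]]]].
- by rewrite /= U3// U1// s1E// inp_n; lia.
- rewrite U1// s1E//; have [] := inp (1 + t)%N _ => //; lia.
- by rewrite U1// s1E//; have [|] := counts (1 + t)%N j _ jr; lia.
exists k2, s3; split=> //.
have n1 : (n.-1 < n)%N by rewrite prednK.
have [E1 E2] := unzip_stub_edges bd n1.
have sz1 : size (stub_edges r L Rt n.-1) = size (stubs Rt r 0 n.-1).
  by rewrite -E1 size_map.
have sz2 : size (stub_edges r L Rt n.-1) = size (stubs L r 1 n.-1).
  by rewrite -E2 size_map.
split.
  have B1 := leq_trans k1B (@stub_cost_le n.-1 0 d Rt r _ _).
  have B2 := leq_trans k2B (@stub_cost_le n.-1 1 d L r _ _).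
  have {}B1 : (k1 <= n.-1 * (3 * d + 1))%N.
    apply: B1 => t tn; first by apply: (fiber_size bd); lia.
    by apply: (sum_right_le bd); lia.
  have {}B2 : (k2 <= n.-1 * (3 * d + 1))%N.
    apply: B2 => t tn; first by apply: (fiber_size bd); lia.
    (* The left stubs over fiber [t + 1] are as many as the right stubs over fiber [t], so the same
       bound applies. *)
    by rewrite add1n -(counts_agree bd); [apply: (sum_right_le bd)|]; lia.
  nia.
split; first by rewrite m3 sz2.
move=> k kE /=.
have kR : (k < size (stubs Rt r 0 n.-1))%N by rewrite -sz1.
have kL : (k < size (stubs L r 1 n.-1))%N by rewrite -sz2.
have [R1 R2] := row1 k kR; have [L1 L2] := row3 k kL.
move: R1 R2 L1 L2; rewrite -E1 -E2 /unzip1 /unzip2.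
rewrite !(nth_map ((0, 0), (0, 0))%N)// => R1 R2 L1 L2.
(* The second pass writes only columns 2 and 3, so the first half of each row survives. *)
by split=> //; rewrite U3.
Qed.

(** * Both steps together and the cubic bound *)

Theorem mainTheorem1 (R : realType) :
  exists step3 step4 : cmd,
  forall C : nat, exists K : nat,
  forall (g : {poly {poly R}}) (d : nat) (xs : seq R) (ys : nat -> seq R)
         (br : nat -> seq (R -> R)) (a b : R) (brL brR : seq (R -> R))
         (s0 : store),
    total_degree g = d ->
    general_position g ->
    good_partition g xs ->
    (size xs <= C * d ^ 2)%N ->
    (forall i : nat, (i < size xs)%N -> real_roots g xs`_i (ys i)) ->
    (forall i : nat, (i.+1 < size xs)%N ->
       extended_branches g xs`_i xs`_i.+1 (br i)) ->
    a < xs`_0 -> branches g a xs`_0 brL ->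
    xs`_(size xs).-1 < b -> branches g xs`_(size xs).-1 b brR ->
    has_input g xs ys s0 ->
    let r i := size (ys i) in
    let L := left_half_branches xs ys br brL in
    let Rt := right_half_branches xs ys br brR in
    exists (k3 k4 : nat) (s3 s4 : store) (E : seq edge),
      [/\ exec step3 s0 k3 s3 /\ has_counts (size xs) r L Rt s3,
          exec step4 s3 k4 s4 /\ has_edges E s4,
          obeys_branch_counts (size xs) r L Rt E
        & (k3 + k4 <= K * d ^ 3)%N].
Proof.
exists count_half_branches, connect_points => C; exists (15 * C)%N.
move=> g d xs ys br a b brL brR s0 <- gp good size_xs roots ext.
move=> ax0 brLP xb brRP inp r L Rt.
have bd := branch_data_of_curve gp good roots ext ax0 brLP xb brRP.
have [_ xs2 _] := good; have n_gt0 : (0 < size xs)%N by exact: leq_trans xs2.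
have [k3 [s3 [e3 [k3B inp3 counts]]]] := runs_count_half_branches bd inp.
have [k4 [s4 [e4 [k4B edges]]]] := runs_connect_points n_gt0 bd inp3 counts.
exists k3, k4, s3, s4, (stub_edges r L Rt (size xs).-1); split=> //.
  exact: (stub_edges_obey bd).
(* Degree 0 would leave no abscissas, while a good partition has at least two. *)
have d_gt0 : (0 < total_degree g)%N.
  by rewrite lt0n; apply: contraTneq size_xs => ->; rewrite muln0 -ltnNge.
(* With [n = size xs], the cost is at most [n * (11 * d + 3) + 1], which is at most [15 * n * d]
   since [n] and [d] are positive; then [n <= C * d ^ 2]. *)
apply: (@leq_trans (15 * (size xs * total_degree g))); first by nia.
by rewrite -mulnA leq_mul2l /= expnSr mulnA leq_mul2r size_xs orbT.
Qed.
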